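(* Let $\varphi : [a,b] \to \mathbb{R}$ be a function of bounded variation with $\varphi(a) = 0$ and $V_a^b \varphi = 1$. Let $\upsilon$, $p$ and $n$ be the functions of total, positive and negative variation of $\varphi$. Then there are sequences $(x_n)_{n\ge1}$ in $[a,b]$ and $(\varepsilon_n)_{n\ge1}$ in $\{\pm 1\}$ such that for every $x \in [a,b]$ we have (a'') $\lim_{N \to \infty} \frac{1}{N} \sum_{k=1}^N \chi_{[a,x)}(x_k) = \upsilon(x)$; (b'') $\lim_{N \to \infty} \frac{1}{N} \sum_{k=1}^N \varepsilon_k \chi_{[a,x)}(x_k) = \varphi(x)$; (c'') $\lim_{N \to \infty} \frac{1}{2N} \sum_{k=1}^N (1 + \varepsilon_k) \chi_{[a,x)}(x_k) = p(x)$; and (d'') $\lim_{N \to \infty} \frac{1}{2N} \sum_{k=1}^N (1 - \varepsilon_k) \chi_{[a,x)}(x_k) = n(x)$.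
   Context: $[a,b]$ is a compact interval of the real line with $a<b$. $\chi_A$ is the characteristic function of $A$. For $\varphi:[a,b]\to\mathbb{R}$ of bounded variation, $V_a^x\varphi$ is the total variation of $\varphi$ on $[a,x]$, and the functions of total, positive and negative variation of $\varphi$ are $\upsilon(x) = V_a^x \varphi$, $p(x) = \frac12(\upsilon(x) + \varphi(x) - \varphi(a))$, $n(x) = \frac12(\upsilon(x) - \varphi(x) + \varphi(a))$ for $x \in [a,b]$. *)

(* Defs.v *)
From mathcomp Require Import all_boot all_order all_algebra.
From mathcomp Require Import all_classical all_reals all_analysis.

Set Implicit Arguments.
Unset Strict Implicit.
Unset Printing Implicit Defensive.

Import Order.TTheory GRing.Theory Num.Theory.
Import numFieldNormedType.Exports.

Local Open Scope classical_set_scope.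
Local Open Scope ring_scope.

(* A function [a, b] -> R is represented by a total function R -> R; the three
   functions below only depend on its values on [a, x]. *)

(* [fine] loses nothing here when f has bounded variation on [a, x]. *)
Definition tot_var {R : realType} (a : R) (f : R -> R) (x : R) : R :=
  fine (total_variation a x f).

(* The library's extended-real-valued [pos_tv] and [neg_tv] omit the
   normalizing term f a. *)
Definition pos_var {R : realType} (a : R) (f : R -> R) (x : R) : R :=
  2^-1 * (tot_var a f x + f x - f a).

Definition neg_var {R : realType} (a : R) (f : R -> R) (x : R) : R :=
  2^-1 * (tot_var a f x - f x + f a).

(* Main.v *)
Require Import Defs.
From mathcomp Require Import all_boot all_order all_algebra.
From mathcomp Require Import all_classical all_reals all_analysis.
From mathcomp Require Import lra zify.

Import Order.TTheory GRing.Theory Num.Theory.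
Import numFieldNormedType.Exports.

Local Open Scope classical_set_scope.
Local Open Scope ring_scope.

(** The total, positive and negative variations satisfy [v = p + n] and
    [phi = p - n], where [p] and [n] are nondecreasing, vanish at [a] and satisfy
    [p b + n b = 1].  So it suffices to split the indices into two classes, one
    with sign [1] and one with sign [-1], in such a way that the points of the
    first class lying in [[a, t[] have asymptotic frequency [p t], and those of
    the second class [n t].  The four limits are then linear combinations.

    The frequencies come from a sequence [u] equidistributed in [[0, 1[], here
    the binary van der Corput sequence ([corput_equidistributed]): an index [k]
    is in the first class when [u k < p b].  In each class, the points are
    obtained by quantile sampling ([sampling_sequence]): for a nondecreasing
    [g] and a value [v], take [x] to be the largest point with [g x <= v], so
    that [x < t] is equivalent to [v < g t].  When [g] jumps, the supremum [s]
    of the points with [g x <= v] need not be attained, and no single point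
    serves for all [t]; instead the [k]-th point is taken in [[a, s]] at
    distance less than [1/(k+1)] from [s], so that the points creep up to the
    place of the jump ([near_maximum]).  The resulting error at [t] only
    concerns values of [v] between the right limit of [g] at [t] and
    [g (t + 1/(k+1))], a window whose length tends to zero, and
    [cvg_average_sandwich] shows that it does not change the frequency. *)

(** * Averages of sequences *)

Definition average (R : realType) (f : nat -> R) (N : nat) : R :=
  N%:R^-1 * \sum_(k < N) f k.

Lemma averageD (R : realType) (f g : nat -> R) :
  average R (fun k => f k + g k) = (fun N => average R f N + average R g N).
Proof. by apply/funext => N; rewrite /average big_split mulrDr. Qed.

Lemma averageB (R : realType) (f g : nat -> R) :
  average R (fun k => f k - g k) = (fun N => average R f N - average R g N).
Proof. by apply/funext => N; rewrite /average sumrB mulrBr. Qed.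

Lemma ler_average (R : realType) (f g : nat -> R) (N : nat) :
  (forall k, f k <= g k) -> average R f N <= average R g N.
Proof.
move=> fg; rewrite /average ler_wpM2l ?invr_ge0 ?ler0n//.
by apply: ler_sum => k _; exact: fg.
Qed.

Lemma cvg_average_initial (R : realType) (M : nat) :
  average R (fun k => (k < M)%N%:R) N @[N --> \oo] --> (0 : R).
Proof.
have bnd N : \sum_(k < N) (k < M)%N%:R <= M%:R :> R.
  rewrite -natr_sum ler_nat; elim: N => [|N IH]; first by rewrite big_ord0.
  have IHN : (\sum_(k < N) (k < M)%N <= N)%N.
    by rewrite -[leqRHS]card_ord -sum1_card leq_sum// => k _; case: (k < M)%N.
  rewrite big_ord_recr /=; case: (ltnP N M) => NM /=; last by rewrite addn0.
  by rewrite addn1 (leq_ltn_trans IHN).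
apply/cvgrPdist_le => e e0; near=> N.
have N0 : 0 < N%:R :> R by rewrite ltr0n; near: N; exact: nbhs_infty_gt.
have s0 : 0 <= \sum_(k < N) (k < M)%N%:R :> R by apply: sumr_ge0.
rewrite sub0r normrN ger0_norm /average; last first.
  by rewrite mulr_ge0// invr_ge0 ltW.
rewrite mulrC ler_pdivrMr//; apply: (le_trans (bnd N)).
rewrite -ler_pdivrMl// mulrC.
by near: N; exact: nbhs_infty_ger.
Unshelve. all: by end_near. Qed.

(** The excess [r] may depend on the tolerance [e]: this is how error terms
    supported on windows of vanishing length are discarded, although no single
    window has frequency zero. *)
Lemma cvg_average_sandwich (R : realType) (f h : nat -> R) (l : R) :
  (forall k, f k <= h k) ->
  average R f N @[N --> \oo] --> l ->
  (forall e : R, 0 < e -> exists (r : nat -> R) (d : R),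
     [/\ d < e, average R r N @[N --> \oo] --> d &
         forall k, h k <= f k + r k]) ->
  average R h N @[N --> \oo] --> l.
Proof.
move=> fh fl excess; apply/cvgrPdist_le => e e0.
have [r [d [de rd hfr]]] := excess e e0.
have e1 : 0 < (e - d) / 2 by lra.
near=> N.
have : `|l - average R f N| <= Num.min e ((e - d) / 2).
  near: N; move/cvgrPdist_le: fl; apply.
  by rewrite lt_min e0 e1.
have : `|d - average R r N| <= (e - d) / 2.
  by near: N; move/cvgrPdist_le: rd; apply.
have := ler_average R f h N fh.
have := ler_average R h _ N hfr; rewrite averageD.
rewrite le_min !ler_norml; lra.
Unshelve. all: by end_near. Qed.

(** * The van der Corput sequence *)

(** The argument [n] bounds the number of binary digits of [k] that are read. *)
Fixpoint corput_digits (R : realType) (n k : nat) : R :=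
  if n is n'.+1 then ((odd k)%:R + corput_digits R n' k./2) / 2 else 0.

(** The binary digits of [k], reflected about the binary point; [k] digits are
    more than enough to exhaust [k]. *)
Definition corput (R : realType) (k : nat) : R := corput_digits R k k.

Lemma corput_digits_stable (R : realType) (n k : nat) :
  (k <= n)%N -> corput_digits R n k = corput R k.
Proof.
have step m j : (j <= m)%N -> corput_digits R m.+1 j = corput_digits R m j.
  elim: m j => [|m IH] j jm; first by case: j jm => //= _; rewrite addr0 mul0r.
  by rewrite [LHS]/= -/(corput_digits R m.+1 j./2) IH//; lia.
elim: n => [|n IH]; first by case: k.
rewrite leq_eqVlt => /predU1P[->//|]; rewrite ltnS => kn.
by rewrite step// IH.
Qed.

Lemma corputE (R : realType) (k : nat) :
  corput R k = ((odd k)%:R + corput R k./2) / 2.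
Proof.
rewrite -(@corput_digits_stable R k.+1)//= corput_digits_stable//; lia.
Qed.

Lemma corput_double (R : realType) (k : nat) :
  corput R k.*2 = corput R k / 2.
Proof. by rewrite corputE odd_double doubleK add0r. Qed.

Lemma corput_doubleS (R : realType) (k : nat) :
  corput R k.*2.+1 = (1 + corput R k) / 2.
Proof. by rewrite corputE /= odd_double uphalf_double. Qed.

Lemma corput_itv (R : realType) (k : nat) : 0 <= corput R k < 1.
Proof.
elim/ltn_ind: k => -[_|k IH]; first by rewrite /corput/= lexx ltr01.
have k2 : (k.+1./2 < k.+1)%N by rewrite ltn_half_double -addnn; lia.
have := IH _ k2; rewrite (corputE R k.+1).
by move: (corput R _) => c; case: (odd _) => /=; lra.
Qed.

Lemma sum_even_odd (R : nmodType) (F : nat -> R) (N : nat) :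
  \sum_(k < N) F k =
  \sum_(k < uphalf N) F k.*2 + \sum_(k < N./2) F k.*2.+1.
Proof.
elim: N => [|N IH]; first by rewrite !big_ord0 addr0.
rewrite big_ord_recr IH /=.
rewrite uphalf_half -[in F N](odd_double_half N); case: (odd N) => /=.
  by rewrite !add1n [X in _ = _ + X]big_ord_recr /= addrA.
by rewrite !add0n [in RHS]big_ord_recr /= addrAC.
Qed.

(** Even indices fall in the lower half of [[0, 1[] and odd ones in the upper
    half, and each half carries a copy of the sequence scaled by [1/2].  Thus
    the count of the terms below [y] among the first [N] reduces to a count for
    about [N/2] terms, at the cost of a rounding error of at most [1].
    Unfolding this [m] times and using the trivial bound at the end gives the
    estimate. *)
Lemma corput_discrepancy (R : realType) (m N : nat) (y : R) : 0 <= y <= 1 ->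
  `|\sum_(k < N) (corput R k < y)%R%:R - N%:R * y| <= N%:R / 2 ^+ m + m%:R.
Proof.
elim: m N y => [|m IH] N y y01.
  have N0 : 0 <= N%:R :> R by rewrite ler0n.
  have cN : \sum_(k < N) (corput R k < y)%R%:R <= N%:R :> R.
    rewrite -[leRHS]mulr1n -[in leRHS](card_ord N) -sumr_const.
    by apply: ler_sum => k _; case: (_ < _).
  have c0 : 0 <= \sum_(k < N) (corput R k < y)%R%:R :> R by apply: sumr_ge0.
  by rewrite expr0 addr0 divr1 ler_norml; nra.
have NE : N%:R = (uphalf N)%:R + (N./2)%:R :> R.
  by rewrite -natrD; congr (_%:R); lia.
have hE : (N./2)%:R <= (uphalf N)%:R :> R by rewrite ler_nat; lia.
have hE1 : (uphalf N)%:R <= (N./2)%:R + 1 :> R by rewrite natr1 ler_nat; lia.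
have p0 : 0 < (2 ^+ m : R)^-1 <= 1.
  rewrite invr_gt0 exprn_gt0 ?invf_le1 ?exprn_gt0//=.
  by rewrite exprn_ege1// ler1n.
rewrite (sum_even_odd R (fun k => (corput R k < y)%R%:R)) exprS invfM -[m.+1%:R]natr1.
under eq_bigr do rewrite corput_double.
under [X in _ + X - _]eq_bigr do rewrite corput_doubleS.
move: IH p0; move: (2 ^+ m)^-1 => p IH p0.
have dy (z : R) : 0 <= z <= 1 ->
    0 <= ((uphalf N)%:R - (N./2)%:R) * z <= z.
  by move=> /andP[z0 z1]; rewrite mulr_ge0 ?ler_piMl//; lra.
case: (leP y (1 / 2)) => y2.
  rewrite [X in _ + X - _]big1 => [|k _]; last first.
    have /andP[ck _] := corput_itv R k.
    by have -> : ((1 + corput R k) / 2 < y) = false by apply/negbTE; lra.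
  under eq_bigr do rewrite ltr_pdivrMr//.
  have := IH (uphalf N) (y * 2) ltac:(lra).
  have := dy y y01; have := dy _ (ltac:(lra) : 0 <= p <= 1).
  rewrite NE; move: (\sum_(_ < _) _) => c.
  rewrite addr0 !ler_norml; lra.
rewrite [X in X + _ - _](_ : _ = (uphalf N)%:R); last first.
  rewrite -[RHS]mulr1n -[in RHS](card_ord (uphalf N)) -sumr_const.
  apply: eq_bigr => k _; have /andP[_ ck] := corput_itv R k.
  by have -> : corput R k / 2 < y by lra.
under eq_bigr do rewrite ltr_pdivrMr// -ltrBrDl.
have := IH N./2 (y * 2 - 1) ltac:(lra).
have := dy (1 - y) ltac:(lra).
have := dy _ (ltac:(lra) : 0 <= p <= 1).
rewrite NE; move: (\sum_(_ < _) _) => c.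
rewrite !ler_norml; lra.
Qed.

Lemma corput_equidistributed (R : realType) (y : R) : 0 <= y <= 1 ->
  average R (fun k => (corput R k < y)%R%:R) N @[N --> \oo] --> y.
Proof.
move=> y01; apply/cvgrPdist_le => e e0.
have e2 : 0 < e / 2 by rewrite divr_gt0.
have [m _ /(_ m (leqnn m))/= hm] := near_infty_natSinv_expn_lt (PosNum e2).
near=> N.
have N0 : 0 < N%:R :> R by rewrite ltr0n; near: N; exact: nbhs_infty_gt.
have mN : m%:R / (e / 2) <= N%:R by near: N; exact: nbhs_infty_ger.
rewrite /average -[X in `|X - _|](mulKf (lt0r_neq0 N0)) -mulrBr normrM.
rewrite gtr0_norm ?invr_gt0// ler_pdivrMl// distrC.
apply: le_trans (corput_discrepancy R m N y y01) _.
move: mN; rewrite ler_pdivrMr// => mN.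
move: hm; rewrite div1r => hm.
have : N%:R / 2 ^+ m <= N%:R * (e / 2) by rewrite ler_pM2l// ltW.
lra.
Unshelve. all: by end_near. Qed.

Lemma corput_equidistributed_itv (R : realType) (c d : R) :
  0 <= c -> c <= d -> d <= 1 ->
  average R (fun k => (c <= corput R k < d)%R%:R) N @[N --> \oo] --> d - c.
Proof.
move=> c0 cd d1.
have -> : (fun k => (c <= corput R k < d)%R%:R) =
    (fun k => (corput R k < d)%R%:R - (corput R k < c)%R%:R) :> (nat -> R).
  apply/funext => k; case: (ltP (corput R k) c) => uc /=.
    by rewrite (lt_le_trans uc cd) subrr.
  by rewrite subr0.
by rewrite averageB; apply: cvgB; apply: corput_equidistributed; lra.
Qed.

(** * Quantile sampling *)

(** A substitute for the maximum of [S]: [x] is the maximum if there is one,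
    and otherwise lies within [e] of the supremum.  The conclusion is phrased
    with the elements of [S] above [x], so that the two cases need not be
    distinguished later. *)
Lemma near_maximum (R : realType) (S : set R) (e : R) : 0 < e -> has_sup S ->
  exists2 x, S x & forall y, S y -> x < y -> y < x + e /\ exists2 z, S z & y < z.
Proof.
move=> e0 supS; have ubS : ubound S (sup S) by exact: sup_upper_bound.
have [Ss|nSs] := pselect (S (sup S)).
  by exists (sup S) => // y /ubS; rewrite leNgt => /negbTE ->.
have [x Sx xs] := sup_adherent e0 supS; exists x => // y Sy xy.
have ys : y < sup S.
  by rewrite lt_neqAle ubS// andbT; apply: contra_notN nSs => /eqP <-.
split; first by lra.
have sy : 0 < sup S - y by lra.
by have [z Sz yz] := sup_adherent sy supS; exists z => //; lra.
Qed.

(** With [v = corput k - c], which is equidistributed in [[0, g b[] over the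
    indices such that [c <= corput k < d], [x k] is a near maximum of the
    points where [g <= v].  If [v < g t], monotonicity gives [x k < t].
    Conversely, if [g t <= v] and yet [x k < t], then [t] is not the maximum and
    is close to the supremum: [v] is at least the infimum [L] of [g] on
    []t, b]], and, for any fixed [s > t], less than [g s] once [k] is large.
    As [g s] can be taken arbitrarily close to [L], these indices have
    arbitrarily small frequency. *)
Lemma sampling_sequence (R : realType) (a b : R) (g : R -> R) (c d : R) :
  a < b -> {in `[a, b] &, nondecreasing_fun g} -> g a = 0 ->
  0 <= c -> c + g b = d -> d <= 1 ->
  exists x : nat -> R,
    (forall k, x k \in `[a, b]) /\
    forall t, t \in `[a, b] ->
      average R (fun k => ((c <= corput R k < d) && (x k < t))%:R) N
        @[N --> \oo] --> g t.
Proof.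
move=> ab ndg ga c0 gbd d1.
have aI : a \in `[a, b] by rewrite in_itv /= lexx ltW.
have bI : b \in `[a, b] by rewrite in_itv /= lexx ltW.
(* The maximum with 0 keeps [a] in [S k] even when [corput k < c]. *)
pose S k := [set x | x \in `[a, b] /\ g x <= Num.max 0 (corput R k - c)].
have supS k : has_sup (S k).
  split; first by exists a; split => //; rewrite ga le_max lexx.
  by exists b => x [+ _]; rewrite in_itv /= => /andP[].
have k0 k : 0 < k.+1%:R^-1 :> R by rewrite invr_gt0.
have [x xS xP] :=
  all_sig2 (fun k => cid2 (near_maximum R (S k) _ (k0 k) (supS k))).
have xI k : x k \in `[a, b] by have [] := xS k.
exists x; split=> // t tI.
have gge0 s : s \in `[a, b] -> 0 <= g s.
  by move=> sI; rewrite -ga ndg//; move: sI; rewrite in_itv /= => /andP[].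
have gle s : s \in `[a, b] -> c + g s <= d.
  by move=> sI; rewrite -gbd lerD2l ndg//; move: sI; rewrite in_itv /= => /andP[].
(* The indices whose point is before [t] although their value is not below [g t]. *)
have late k : c <= corput R k < d -> x k < t -> ~~ (c <= corput R k < c + g t) ->
    t < x k + k.+1%:R^-1 /\ exists2 z, S k z & t < z.
  move=> /andP[cu _] xt; rewrite cu /= -leNgt => tu.
  apply: xP => //; split => //.
  by rewrite le_max; apply/orP; right; lra.
have maxE k : c <= corput R k -> Num.max 0 (corput R k - c) = corput R k - c.
  by move=> cu; rewrite max_r// subr_ge0.
have gt0 := gge0 t tI; have gtd := gle t tI.
apply: (cvg_average_sandwich R (fun k => (c <= corput R k < c + g t)%R%:R)).
- move=> k; case: (boolP (c <= corput R k < c + g t)) => //= /andP[cu ut].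
  rewrite cu (lt_le_trans ut gtd)/= ltNge; case: (leP t (x k)) => //= tx.
  have [_ +] := xS k; rewrite maxE// => gx.
  have : g t <= g (x k) by exact: ndg.
  lra.
- rewrite [X in _ --> X](_ : _ = c + g t - c); last lra.
  by apply: corput_equidistributed_itv; lra.
move=> e e0; have [tb|bt] := ltP t b; last first.
  have tE : t = b by apply/le_anti; rewrite bt andbT; move: tI;
    rewrite in_itv /= => /andP[].
  exists (fun k => (k < 0)%N%:R), 0; split => //; first exact: cvg_average_initial.
  move=> k; rewrite addr0; case: (boolP (_ && (x k < t))) => //= /andP[cud xt].
  case: (boolP (c <= corput R k < c + g t)) => //= late_k.
  have [_ [z [zI _] tz]] := late k cud xt late_k.
  by move: zI; rewrite in_itv /= => /andP[_ zb]; lra.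
(* [inf A] is the right limit of [g] at [t]. *)
pose A := g @` `]t, b].
have tbI s : t < s <= b -> s \in `[a, b].
  by move=> ?; move: tI; rewrite !in_itv /=; lra.
have lbA : lbound A (g t).
  move=> _ [s /= sI <-]; move: sI; rewrite in_itv /= => sI.
  by apply: ndg => //; [exact: tbI | lra].
have infA : has_inf A.
  by split; [exists (g b), b => //=; rewrite in_itv /= tb lexx | exists (g t)].
have gtL : g t <= inf A by apply: lb_le_inf => //; case: infA.
have [_ [s /= sI <-] sL] := inf_adherent e0 infA.
have As : A (g s) by exists s.
have Ls : inf A <= g s by apply: ge_inf => //; case: infA.
move: sI; rewrite in_itv /= => sI.
have gsd := gle s (tbI s sI).
have st0 : 0 < s - t by lra.
have [M _ Mst] := near_infty_natSinv_lt (PosNum st0).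
exists (fun k => (c + inf A <= corput R k < c + g s)%R%:R + (k < M)%N%:R).
exists (c + g s - (c + inf A) + 0); split; first lra.
  rewrite averageD; apply: cvgD; last exact: cvg_average_initial.
  by apply: corput_equidistributed_itv; lra.
move=> k; case: (ltnP k M) => /= kM.
  by rewrite addrA ler_wpDl ?addr_ge0//; case: (_ && _).
rewrite addr0; case: (boolP (_ && (x k < t))) => /= [/andP[cud xt]|_]; last first.
  by rewrite addr_ge0.
case: (boolP (c <= corput R k < c + g t)) => /= late_k; first by rewrite ler_wpDr.
have [tx [z [zI gz] tz]] := late k cud xt late_k.
have /andP[cu ud] := cud.
have us : corput R k < c + g s.
  rewrite ltNge; apply/negP => su.
  have [] := xP k s; first by split; [exact: tbI | rewrite maxE//; lra].
    by lra.
  have Mk : k.+1%:R^-1 < s - t := Mst k kM.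
  by move=> sx _; move: sx Mk; move: (k.+1%:R^-1) => r; lra.
have Lz : inf A <= g z.
  apply: ge_inf; first by case: infA.
  by exists z => //=; move: zI; rewrite !in_itv /= tz => /andP[].
move: gz; rewrite maxE// => gz.
have -> : c + inf A <= corput R k by lra.
by rewrite us add0r.
Qed.

(** * The variation functions *)

Lemma neg_varE (R : realType) (a : R) (f : R -> R) :
  neg_var a f = pos_var a (\- f).
Proof.
by apply/funext => x; rewrite /neg_var /pos_var /tot_var total_variationN opprK.
Qed.

(** On [[s, t]] the total variation increases by at least [|f t - f s|]. *)
Lemma pos_var_nondecreasing (R : realType) (a b : R) (f : R -> R) :
  bounded_variation a b f ->
  {in `[a, b] &, nondecreasing_fun (pos_var a f)}.
Proof.
move=> bv s t; rewrite !in_itv /= => /andP[as_ sb] /andP[at_ tb] st.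
have bvs : bounded_variation a s f by exact: bounded_variationl bv.
have bvt : bounded_variation s t f.
  exact: (bounded_variationr as_ st (bounded_variationl at_ tb bv)).
have fs : total_variation a s f \is a fin_num by apply/bounded_variationP.
have ft : total_variation s t f \is a fin_num by apply/bounded_variationP.
have := total_variation_ge f st; rewrite -(fineK ft) lee_fin.
rewrite /pos_var /tot_var (total_variationD f as_ st) fineD// ler_norml; lra.
Qed.

Lemma pos_var_left (R : realType) (a : R) (f : R -> R) : pos_var a f a = 0.
Proof. by rewrite /pos_var /tot_var total_variationxx add0r subrr mulr0. Qed.

(** * Sequences realizing the variation functions *)

Theorem theorem9 (R : realType) (a b : R) (hab : a < b) (phi : R -> R)
    (phi_bv : bounded_variation a b phi) (phi_a : phi a = 0)
    (phi_tv : total_variation a b phi = 1%E) :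
  exists (x : nat -> R) (eps : nat -> R),
    [/\ forall n : nat, (1 <= n)%N -> x n \in `[a, b],
        forall n : nat, (1 <= n)%N -> eps n = 1 \/ eps n = -1 &
        forall t : R, t \in `[a, b] ->
          [/\ (N%:R^-1 * \sum_(1 <= k < N.+1) \1_(`[a, t[) (x k) : R)
                @[N --> \oo] --> tot_var a phi t,
              (N%:R^-1 * \sum_(1 <= k < N.+1) eps k * \1_(`[a, t[) (x k) : R)
                @[N --> \oo] --> phi t,
              ((2 * N%:R)^-1 *
                 \sum_(1 <= k < N.+1) (1 + eps k) * \1_(`[a, t[) (x k) : R)
                @[N --> \oo] --> pos_var a phi t &
              ((2 * N%:R)^-1 *
                 \sum_(1 <= k < N.+1) (1 - eps k) * \1_(`[a, t[) (x k) : R)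
                @[N --> \oo] --> neg_var a phi t]].
Proof.
pose p := pos_var a phi; pose n := neg_var a phi.
have aI : a \in `[a, b] by rewrite in_itv /= lexx ltW.
have bI : b \in `[a, b] by rewrite in_itv /= lexx ltW.
have p_nd : {in `[a, b] &, nondecreasing_fun p} by exact: pos_var_nondecreasing.
have n_nd : {in `[a, b] &, nondecreasing_fun n}.
  by rewrite /n neg_varE; apply: pos_var_nondecreasing; exact: bounded_variationN.
have pa : p a = 0 by exact: pos_var_left.
have na : n a = 0 by rewrite /n neg_varE pos_var_left.
have pDn t : p t + n t = tot_var a phi t by rewrite /p /n /pos_var /neg_var; lra.
have pBn t : p t - n t = phi t by rewrite /p /n /pos_var /neg_var phi_a; lra.
have pn1 : p b + n b = 1 by rewrite pDn /tot_var phi_tv.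
have pb0 : 0 <= p b by rewrite -pa; apply: p_nd => //; exact: ltW.
have nb0 : 0 <= n b by rewrite -na; apply: n_nd => //; exact: ltW.
have [xp [xpI xp_cvg]] : exists x : nat -> R, (forall k, x k \in `[a, b]) /\
    forall t, t \in `[a, b] ->
      average R (fun k => ((0 <= corput R k < p b) && (x k < t))%:R) N
        @[N --> \oo] --> p t.
  by apply: sampling_sequence => //; lra.
have [xn [xnI xn_cvg]] : exists x : nat -> R, (forall k, x k \in `[a, b]) /\
    forall t, t \in `[a, b] ->
      average R (fun k => ((p b <= corput R k < 1) && (x k < t))%:R) N
        @[N --> \oo] --> n t.
  by apply: sampling_sequence => //; lra.
(* Sums start at index 1, hence the shift by the predecessor. *)
pose x k := if corput R k.-1 < p b then xp k.-1 else xn k.-1.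
pose eps k : R := if corput R k.-1 < p b then 1 else -1.
exists x, eps; split.
- by move=> k _; rewrite /x; case: ifP.
- by move=> k _; rewrite /eps; case: ifP; [left|right].
move=> t tI.
pose Fp k : R := ((0 <= corput R k < p b) && (xp k < t))%:R.
pose Fn k : R := ((p b <= corput R k < 1) && (xn k < t))%:R.
have cvgp : average R Fp N @[N --> \oo] --> p t := xp_cvg t tI.
have cvgn : average R Fn N @[N --> \oo] --> n t := xn_cvg t tI.
have in_at y : y \in `[a, b] -> \1_(`[a, t[) y = (y < t)%R%:R :> R.
  rewrite in_itv /= => /andP[ay _].
  by rewrite indicE mem_setE in_itv /= ay.
have indF k : \1_(`[a, t[) (x k.+1) = Fp k + Fn k.
  have /andP[u0 u1] := corput_itv R k.
  rewrite in_at /x /Fp /Fn/= ?u0 ?u1 ?andbT; last by case: ifP.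
  by case: (ltP (corput R k) (p b)) => _ /=; rewrite ?addr0 ?add0r.
have epsF k : eps k.+1 * \1_(`[a, t[) (x k.+1) = Fp k - Fn k.
  have /andP[u0 u1] := corput_itv R k.
  rewrite in_at /x /eps /Fp /Fn/= ?u0 ?u1 ?andbT; last by case: ifP.
  by case: (ltP (corput R k) (p b)) => _ /=; rewrite ?mul1r ?mulN1r ?subr0 ?sub0r.
have shift (F : nat -> R) N : \sum_(1 <= k < N.+1) F k = \sum_(k < N) F k.+1.
  by rewrite big_add1 big_mkord.
have sum2 (F : nat -> R) N : (2 * N%:R)^-1 * \sum_(k < N) (2 * F k) = average R F N.
  by rewrite -mulr_sumr invfM /average mulrACA mulVf// mul1r.
split.
- rewrite (_ : (fun _ => _) = average R (fun k => Fp k + Fn k)); last first.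
    by apply/funext => N; rewrite shift; under eq_bigr do rewrite indF.
  by rewrite averageD -pDn; apply: cvgD.
- rewrite (_ : (fun _ => _) = average R (fun k => Fp k - Fn k)); last first.
    by apply/funext => N; rewrite shift; under eq_bigr do rewrite epsF.
  by rewrite averageB -pBn; apply: cvgB.
- rewrite (_ : (fun _ => _) = average R Fp)//; apply/funext => N.
  rewrite shift -sum2; congr (_ * _); apply: eq_bigr => k _.
  by rewrite mulrDl mul1r epsF indF; lra.
- rewrite (_ : (fun _ => _) = average R Fn)//; apply/funext => N.
  rewrite shift -sum2; congr (_ * _); apply: eq_bigr => k _.
  by rewrite mulrBl mul1r epsF indF; lra.
Qed.
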